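(* Let $\mathcal S\colon\mathtt C\to\mathtt{FVec}$ be a stem, let $X$ be a finite-dimensional real vector space and let $D\subseteq X$ be a closed convex cone. (i) For $c\in\mathtt C$ define $\underline{\mathcal G}_D(c):=D\mathbin{\underline{\otimes}}B(c)$. Then $\underline{\mathcal G}_D$ is the smallest $\mathcal S$-system on $X$ that contains the cone $D$ at level $\mathbf 1$ (i.e. it is an $\mathcal S$-system with $D\subseteq\underline{\mathcal G}_D(\mathbf 1)$, and $\underline{\mathcal G}_D\subseteq\mathcal G$ for every $\mathcal S$-system $\mathcal G$ on $X$ with $D\subseteq\mathcal G(\mathbf 1)$). (ii) For $c\in\mathtt C$ define $\overline{\mathcal G}_D(c):=D\mathbin{\overline{\otimes}}A(c)$. Then $\overline{\mathcal G}_D$ is the largest $\mathcal S$-system on $X$ that is contained in $D$ at level $\mathbf 1^*$ (i.e. it is an $\mathcal S$-system with $\overline{\mathcal G}_D(\mathbf 1^* )\subseteq D$, and $\mathcal G\subseteq\overline{\mathcal G}_D$ for every $\mathcal S$-system $\mathcal G$ on $X$ with $\mathcal G(\mathbf 1^* )\subseteq D$).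
   Context: All vector spaces are finite-dimensional and real; $\mathtt{FVec}$ is the category of these with linear maps, $\mathrm{Lin}(V,W)$ is the space of linear maps, $V'=\mathrm{Lin}(V,\mathbb R)$. For a convex cone $C\subseteq V$, $C^\vee=\{\varphi\in V'\mid\varphi(x)\ge 0\ \forall x\in C\}$. For convex cones $C\subseteq V$, $D\subseteq W$: $C\mathbin{\underline{\otimes}}D=\{\sum_i c_i\otimes d_i\mid c_i\in C,d_i\in D\}\subseteq V\otimes W$ (finite sums), and $C\mathbin{\overline{\otimes}}D=(C^\vee\mathbin{\underline{\otimes}}D^\vee)^\vee$, using $V''=V$. A star autonomous category is a symmetric monoidal category $(\mathtt C,\otimes,\mathbf 1)$ with a full and faithful functor ${}^*\colon\mathtt C^{\mathrm{op}}\to\mathtt C$ and a natural bijection $\mathtt C(a\otimes b,c)\cong\mathtt C(a,(b\otimes c^* )^* )$. $\mathtt{FVec}$ is star autonomous with the usual tensor product and dual. A stem is a star autonomous functor $\mathcal S\colon\mathtt C\to\mathtt{FVec}$, where $\mathtt C$ is star autonomous: i.e. a strong monoidal functor with natural isomorphisms $\mathcal S(c^* )\cong\mathcal S(c)'$, such that $\mathcal S$ carries the bijection $\mathtt C(a\otimes b,c)\cong\mathtt C(a,(b\otimes c^* )^* )$ to the corresponding bijection in $\mathtt{FVec}$. These isomorphisms are written as equalities: $\mathcal S(\mathbf 1)=\mathbb R$, $\mathcal S(\mathbf 1^* )=\mathbb R'=\mathbb R$, $\mathcal S(c\otimes d)=\mathcal S(c)\otimes\mathcal S(d)$, $\mathcal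 S(c^* )=\mathcal S(c)'$; also $X\otimes\mathcal S(\mathbf 1)=X=X\otimes\mathcal S(\mathbf 1^* )$. For $c\in\mathtt C$ the intrinsic and cointrinsic cones are $A(c)=\{v\in\mathcal S(c)\mid\mathcal S(\varphi)(v)\ge 0\ \forall\varphi\in\mathtt C(c,\mathbf 1^* )\}$ and $B(c)=\overline{\mathrm{cone}}\{\mathcal S(\Phi)(1)\mid\Phi\in\mathtt C(\mathbf 1,c)\}$ (closed conic hull). An $\mathcal S$-system $\mathcal G$ on $X$ is a family of closed convex cones $\mathcal G(c)\subseteq X\otimes\mathcal S(c)$, $c\in\mathtt C$, with $(\mathrm{id}_X\otimes\mathcal S(\Phi))(\mathcal G(c))\subseteq\mathcal G(d)$ for all $\Phi\in\mathtt C(c,d)$. For systems on the same $X$, $\mathcal G\subseteq\mathcal E$ means $\mathcal G(c)\subseteq\mathcal E(c)$ for all $c$. *)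

(* Defs.v *)
From HB Require Import structures.
From mathcomp Require Import all_boot all_order all_algebra.
From mathcomp Require Import all_classical all_reals all_analysis.
Set Implicit Arguments.
Unset Strict Implicit.
Unset Printing Implicit Defensive.
Import Order.TTheory GRing.Theory Num.Theory.
Import numFieldNormedType.Exports VectorInternalTheory.
Local Open Scope classical_set_scope.
Local Open Scope ring_scope.

Record category := Category {
  ob :> Type;
  mor : ob -> ob -> Type;
  idm : forall a, mor a a;
  cmp : forall a b c, mor b c -> mor a b -> mor a c;
  cmp1m : forall a b (f : mor a b), cmp (idm b) f = f;
  cmpm1 : forall a b (f : mor a b), cmp f (idm a) = f;
  cmpA : forall a b c d (h : mor c d) (g : mor b c) (f : mor a b),
    cmp h (cmp g f) = cmp (cmp h g) f }.
Arguments mor {c} : rename.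
Arguments idm {c} a : rename.
Arguments cmp {c a b} {c0} : rename.

Declare Scope cat_scope.
Delimit Scope cat_scope with cat.
Local Open Scope cat_scope.
Notation "g ∘ f" := (cmp g f) (at level 40, left associativity) : cat_scope.

Definition is_iso (C : category) (a b : C) (f : mor a b) :=
  exists g : mor b a, g ∘ f = idm a /\ f ∘ g = idm b.

Record sym_monoidal := SymMonoidal {
  smcat :> category;
  tob : smcat -> smcat -> smcat;
  tmor : forall a a' b b' : smcat,
    mor a a' -> mor b b' -> mor (tob a b) (tob a' b');
  unit_ob : smcat;
  assoc : forall a b c, mor (tob (tob a b) c) (tob a (tob b c));
  lunit : forall a, mor (tob unit_ob a) a;
  runit : forall a, mor (tob a unit_ob) a;
  braid : forall a b, mor (tob a b) (tob b a);
  tmor1 : forall a b, tmor (idm a) (idm b) = idm (tob a b);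
  tmor_cmp : forall a a' a'' b b' b''
      (f' : mor a' a'') (f : mor a a') (g' : mor b' b'') (g : mor b b'),
    tmor (f' ∘ f) (g' ∘ g) = tmor f' g' ∘ tmor f g;
  assoc_iso : forall a b c, is_iso (assoc a b c);
  lunit_iso : forall a, is_iso (lunit a);
  runit_iso : forall a, is_iso (runit a);
  assoc_nat : forall a a' b b' c c'
      (f : mor a a') (g : mor b b') (h : mor c c'),
    assoc a' b' c' ∘ tmor (tmor f g) h = tmor f (tmor g h) ∘ assoc a b c;
  lunit_nat : forall a a' (f : mor a a'),
    lunit a' ∘ tmor (idm unit_ob) f = f ∘ lunit a;
  runit_nat : forall a a' (f : mor a a'),
    runit a' ∘ tmor f (idm unit_ob) = f ∘ runit a;
  braid_nat : forall a a' b b' (f : mor a a') (g : mor b b'),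
    braid a' b' ∘ tmor f g = tmor g f ∘ braid a b;
  pentagon : forall a b c d,
    assoc a b (tob c d) ∘ assoc (tob a b) c d =
    tmor (idm a) (assoc b c d) ∘ assoc a (tob b c) d
      ∘ tmor (assoc a b c) (idm d);
  triangle : forall a b,
    tmor (idm a) (lunit b) ∘ assoc a unit_ob b = tmor (runit a) (idm b);
  hexagon : forall a b c,
    assoc b c a ∘ braid a (tob b c) ∘ assoc a b c =
    tmor (idm b) (braid a c) ∘ assoc b a c ∘ tmor (braid a b) (idm c);
  braidK : forall a b, braid b a ∘ braid a b = idm (tob a b) }.
Arguments tob {s} : rename.
Arguments tmor {s a a' b b'} : rename.
Arguments unit_ob {s} : rename.
Arguments assoc {s} a b c : rename.
Arguments lunit {s} a : rename.
Arguments runit {s} a : rename.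
Arguments braid {s} a b : rename.

Notation "a ⊗ b" := (tob a b) (at level 39, left associativity) : cat_scope.
Notation "f ⊠ g" := (tmor f g) (at level 39, left associativity) : cat_scope.
Notation "𝟏" := unit_ob : cat_scope.

Record star_autonomous := StarAutonomous {
  sacat :> sym_monoidal;
  star : sacat -> sacat;
  starm : forall a b : sacat, mor a b -> mor (star b) (star a);
  starm1 : forall a, starm (idm a) = idm (star a);
  starm_cmp : forall a b c (g : mor b c) (f : mor a b),
    starm (g ∘ f) = starm f ∘ starm g;
  starm_ff : forall a b, bijective (@starm a b);
  curry : forall a b c : sacat, mor (a ⊗ b) c -> mor a (star (b ⊗ star c));
  curry_bij : forall a b c, bijective (@curry a b c);
  curry_natl : forall a' a b c (f : mor (a ⊗ b) c) (h : mor a' a),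
    curry (f ∘ (h ⊠ idm b)) = curry f ∘ h;
  curry_natm : forall a b' b c (f : mor (a ⊗ b) c) (h : mor b' b),
    curry (f ∘ (idm a ⊠ h)) = starm (h ⊠ idm (star c)) ∘ curry f;
  curry_natr : forall a b c c' (f : mor (a ⊗ b) c) (h : mor c c'),
    curry (h ∘ f) = starm (idm b ⊠ starm h) ∘ curry f }.
Arguments star {s} : rename.
Arguments starm {s a b} : rename.
Arguments curry {s a b c} : rename.

(* Strong monoidal functors come with the isomorphisms [fmu] and [feps];
   a star autonomous functor additionally with the isomorphisms [fdelta]. *)
Record star_functor (C D : star_autonomous) := StarFunctor {
  fob :> C -> D;
  fmor : forall a b : C, mor a b -> mor (fob a) (fob b);
  fmor1 : forall a, fmor (idm a) = idm (fob a);
  fmor_cmp : forall a b c (g : mor b c) (f : mor a b),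
    fmor (g ∘ f) = fmor g ∘ fmor f;
  fmu : forall a b, mor (fob a ⊗ fob b) (fob (a ⊗ b));
  feps : mor 𝟏 (fob 𝟏);
  fmu_iso : forall a b, is_iso (fmu a b);
  feps_iso : is_iso feps;
  fmu_nat : forall a a' b b' (f : mor a a') (g : mor b b'),
    fmu a' b' ∘ (fmor f ⊠ fmor g) = fmor (f ⊠ g) ∘ fmu a b;
  fmu_assoc : forall a b c,
    fmu a (b ⊗ c) ∘ (idm (fob a) ⊠ fmu b c)
      ∘ assoc (fob a) (fob b) (fob c) =
    fmor (assoc a b c) ∘ fmu (a ⊗ b) c ∘ (fmu a b ⊠ idm (fob c));
  fmu_lunit : forall a,
    fmor (lunit a) ∘ fmu 𝟏 a ∘ (feps ⊠ idm (fob a)) = lunit (fob a);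
  fmu_runit : forall a,
    fmor (runit a) ∘ fmu a 𝟏 ∘ (idm (fob a) ⊠ feps) = runit (fob a);
  fdelta : forall a, mor (fob (star a)) (star (fob a));
  fdelta_iso : forall a, is_iso (fdelta a);
  fdelta_nat : forall a b (f : mor a b),
    fdelta a ∘ fmor (starm f) = starm (fmor f) ∘ fdelta b;
  (* S(b ⊗ c^* )^* is compared with (S b ⊗ (S c)^* )^* inside
     (S b ⊗ S(c^* ))^*, which avoids the inverses of [fmu] and [fdelta]. *)
  fcurry : forall a b c (f : mor (a ⊗ b) c),
    starm (fmu b (star c)) ∘ fdelta (b ⊗ star c) ∘ fmor (curry f) =
    starm (idm (fob b) ⊠ fdelta c) ∘ curry (fmor f ∘ fmu a b) }.
Arguments fmor {C D} s {a b} : rename.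
Arguments fmu {C D} s a b : rename.
Arguments feps {C D} s : rename.
Arguments fdelta {C D} s a : rename.

Section FVec.
Variable R : realType.
Implicit Types U V W X Y : vectType R.

Definition dual V : vectType R := 'Hom(V, R^o).

(* V ⊗ W is modelled as Lin(W', V), with v ⊗ w the map phi |-> phi(w) v. *)
Definition tensor V W : vectType R := 'Hom(dual W, V).

Definition tens V W (v : V) (w : W) : tensor V W :=
  linfun (fun phi : dual W => phi w *: v).

Definition ebasis W (j : 'I_(\dim {:W})) : W := (vbasis {:W})`_j.
Definition edual W (j : 'I_(\dim {:W})) : dual W :=
  linfun (coord (vbasis {:W}) j : W -> R^o).

(* The linear map on V ⊗ W induced by a bilinear f; see [tliftE]. *)
Definition tlift V W U (f : V -> W -> U) : 'Hom(tensor V W, U) :=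
  linfun (fun t : tensor V W => \sum_j f (t (edual j)) (ebasis j)).

Definition bilin V W U (f : V -> W -> U) :=
  (forall v, linear (f v)) /\ (forall w, linear (f^~ w)).

Lemma linfunE V W (f : V -> W) : linear f -> linfun f =1 f.
Proof.
move=> lf x.
pose g : {linear V -> W} :=
  HB.pack f (GRing.isLinear.Build R V W *:%R f lf).
exact: (lfunE g x).
Qed.

Lemma linear_sum_fun V W (f : V -> W) I (r : seq I) (P : pred I) (F : I -> V) :
  linear f -> f (\sum_(i <- r | P i) F i) = \sum_(i <- r | P i) f (F i).
Proof.
move=> lf; rewrite -(linfunE lf) linear_sum.
by apply: eq_bigr => i _; exact: linfunE.
Qed.

Lemma linear_scale_fun V W (f : V -> W) a x : linear f -> f (a *: x) = a *: f x.
Proof. by move=> lf; rewrite -!(linfunE lf) linearZ. Qed.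

Lemma hom_linear V W (f : 'Hom(V, W)) : linear f.
Proof. by move=> a x y; rewrite linearP. Qed.

Lemma edualE W j (w : W) : edual j w = coord (vbasis {:W}) j w.
Proof. by rewrite linfunE // => a x y; rewrite linearP. Qed.

Lemma ebasis_sum W (w : W) : w = \sum_j edual j w *: ebasis j.
Proof.
rewrite {1}(coord_vbasis (memvf w)).
by apply: eq_bigr => j _; rewrite edualE.
Qed.

Lemma edual_sum W (phi : dual W) : phi = \sum_j phi (ebasis j) *: edual j.
Proof.
apply/lfunP => w; rewrite {1}(ebasis_sum w) linear_sum sum_lfunE.
by apply: eq_bigr => j _; rewrite linearZ scale_lfunE; exact: mulrC.
Qed.

Lemma tensE V W (v : V) (w : W) (phi : dual W) : tens v w phi = phi w *: v.
Proof.
by rewrite linfunE // => a x y; rewrite add_lfunE scale_lfunE scalerDl -scalerA.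
Qed.

Lemma tens_bilin V W : bilin (@tens V W).
Proof.
split=> [v|w] a x y; apply/lfunP => phi; rewrite add_lfunE scale_lfunE !tensE.
  by rewrite linearP scalerDl -scalerA.
by rewrite scalerDr !scalerA mulrC.
Qed.

Lemma tens_sum V W (t : tensor V W) : t = \sum_j tens (t (edual j)) (ebasis j).
Proof.
apply/lfunP => phi; rewrite {1}(edual_sum phi) linear_sum sum_lfunE.
by apply: eq_bigr => j _; rewrite linearZ tensE.
Qed.

Lemma tlift_sum V W U (f : V -> W -> U) t : bilin f ->
  tlift f t = \sum_j f (t (edual j)) (ebasis j).
Proof.
move=> [fr fl]; rewrite linfunE // => a x y; rewrite scaler_sumr -big_split.
by apply: eq_bigr => j _ /=; rewrite add_lfunE scale_lfunE fl.
Qed.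

Lemma tliftE V W U (f : V -> W -> U) v w :
  bilin f -> tlift f (tens v w) = f v w.
Proof.
move=> bf; rewrite tlift_sum //; case: bf => fr fl.
rewrite {2}(ebasis_sum w) (linear_sum_fun _ _ _ (fr v)).
apply: eq_bigr => j _; rewrite tensE (linear_scale_fun _ _ (fr v)).
exact: (linear_scale_fun _ _ (fl (ebasis j))).
Qed.

Lemma tens_ext V W U (f g : 'Hom(tensor V W, U)) :
  (forall v w, f (tens v w) = g (tens v w)) -> f = g.
Proof.
move=> fg; apply/lfunP => t; rewrite (tens_sum t) !linear_sum.
by apply: eq_bigr => j _; exact: fg.
Qed.

Lemma tens_ext3l V W X U (f g : 'Hom(tensor (tensor V W) X, U)) :
  (forall v w x, f (tens (tens v w) x) = g (tens (tens v w) x)) -> f = g.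
Proof.
move=> fg; apply: tens_ext => t x; rewrite (tens_sum t).
have lx := (@tens_bilin (tensor V W) X).2 x.
rewrite (linear_sum_fun _ _ _ lx) !linear_sum.
by apply: eq_bigr => j _; exact: fg.
Qed.

Lemma tens_ext3r V W X U (f g : 'Hom(tensor V (tensor W X), U)) :
  (forall v w x, f (tens v (tens w x)) = g (tens v (tens w x))) -> f = g.
Proof.
move=> fg; apply: tens_ext => v t; rewrite (tens_sum t).
have lv := (@tens_bilin V (tensor W X)).1 v.
rewrite (linear_sum_fun _ _ _ lv) !linear_sum.
by apply: eq_bigr => j _; exact: fg.
Qed.

Lemma tlift_param X V W U (F : X -> V -> W -> U) t :
  (forall x, bilin (F x)) -> (forall v w, linear (fun x => F x v w)) ->
  linear (fun x => tlift (F x) t).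
Proof.
move=> bF lF a x y; rewrite !tlift_sum // scaler_sumr -big_split.
by apply: eq_bigr => j _; rewrite lF.
Qed.

Lemma comp_lfun_idl V W (f : 'Hom(V, W)) : (\1 \o f)%VF = f.
Proof. exact: comp_lfun1l. Qed.
Lemma comp_lfun_idr V W (f : 'Hom(V, W)) : (f \o \1)%VF = f.
Proof. exact: comp_lfun1r. Qed.

Definition FVec_cat : category :=
  @Category (vectType R) (fun V W => 'Hom(V, W)) (fun V => \1%VF)
    (fun V W U g f => (g \o f)%VF)
    comp_lfun_idl comp_lfun_idr (fun _ _ _ _ h g f => comp_lfunA h g f).

Definition tensor_map V V' W W' (f : 'Hom(V, V')) (g : 'Hom(W, W')) :
    'Hom(tensor V W, tensor V' W') :=
  tlift (fun v w => tens (f v) (g w)).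

Definition tensor_assoc U V W :
    'Hom(tensor (tensor U V) W, tensor U (tensor V W)) :=
  tlift (fun t w => tlift (fun u v => tens u (tens v w)) t).

Definition tensor_assoc_inv U V W :
    'Hom(tensor U (tensor V W), tensor (tensor U V) W) :=
  tlift (fun u t => tlift (fun v w => tens (tens u v) w) t).

Definition tensor_lunit V : 'Hom(tensor R^o V, V) :=
  tlift (fun (a : R^o) v => (a : R) *: v).

Definition tensor_runit V : 'Hom(tensor V R^o, V) :=
  tlift (fun v (a : R^o) => (a : R) *: v).

Definition tensor_braid V W : 'Hom(tensor V W, tensor W V) :=
  tlift (fun v w => tens w v).

Definition dual_map V W (f : 'Hom(V, W)) : 'Hom(dual W, dual V) :=
  linfun (fun phi : dual W => (phi \o f)%VF : dual V).

Definition tensor_curry V W U (f : 'Hom(tensor V W, U)) :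
    'Hom(V, dual (tensor W (dual U))) :=
  linfun (fun v => tlift (fun w (phi : dual U) => phi (f (tens v w)))).

Lemma tensDl V W (w : W) a (x y : V) :
  tens (a *: x + y) w = a *: tens x w + tens y w.
Proof. exact: (tens_bilin V W).2. Qed.
Lemma tensDr V W (v : V) a (x y : W) :
  tens v (a *: x + y) = a *: tens v x + tens v y.
Proof. exact: (tens_bilin V W).1. Qed.

Lemma tensor_mapE V V' W W' (f : 'Hom(V, V')) (g : 'Hom(W, W')) v w :
  tensor_map f g (tens v w) = tens (f v) (g w).
Proof.
by apply: tliftE; split=> [v0|w0] a x y; rewrite linearP ?tensDl ?tensDr.
Qed.

Lemma tensor_assocE U V W (u : U) (v : V) (w : W) :
  tensor_assoc U V W (tens (tens u v) w) = tens u (tens v w).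
Proof.
have b w0 : bilin (fun (u : U) (v : V) => tens u (tens v w0)).
  by split=> [u0|v0] a x y; rewrite ?tensDl ?tensDr.
rewrite [LHS]tliftE ?tliftE //; split=> [t|w0]; last exact: hom_linear.
by apply: tlift_param => // u0 v0 a x y; rewrite !tensDr.
Qed.

Lemma tensor_assoc_invE U V W (u : U) (v : V) (w : W) :
  tensor_assoc_inv U V W (tens u (tens v w)) = tens (tens u v) w.
Proof.
have b u0 : bilin (fun (v : V) (w : W) => tens (tens u0 v) w).
  by split=> [v0|w0] a x y; rewrite ?tensDr ?tensDl.
rewrite [LHS]tliftE ?tliftE //; split=> [u0|t]; first exact: hom_linear.
by apply: tlift_param => // v0 w0 a x y; rewrite !tensDl.
Qed.

Lemma tensor_lunitE V (a : R^o) (v : V) :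
  tensor_lunit V (tens a v) = (a : R) *: v.
Proof.
apply: tliftE; split=> [b|w] c x y; first by rewrite scalerDr !scalerA mulrC.
by rewrite scalerDl -scalerA.
Qed.

Lemma tensor_runitE V (v : V) (a : R^o) :
  tensor_runit V (tens v a) = (a : R) *: v.
Proof.
apply: tliftE; split=> [w|b] c x y; last by rewrite scalerDr !scalerA mulrC.
by rewrite scalerDl -scalerA.
Qed.

Lemma tensor_braidE V W (v : V) (w : W) : tensor_braid V W (tens v w) = tens w v.
Proof. by apply: tliftE; split=> [v0|w0] a x y; rewrite ?tensDl ?tensDr. Qed.

Lemma dual_mapE V W (f : 'Hom(V, W)) (phi : dual W) v :
  dual_map f phi v = phi (f v).
Proof.
by rewrite linfunE ?comp_lfunE // => a x y; rewrite comp_lfunDl comp_lfunZl.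
Qed.

Lemma tensor_curryE V W U (f : 'Hom(tensor V W, U)) v w (phi : dual U) :
  tensor_curry f v (tens w phi) = phi (f (tens v w)).
Proof.
have b v0 : bilin (fun w (phi : dual U) => phi (f (tens v0 w))).
  split=> [w0|p] a x y; first by rewrite add_lfunE scale_lfunE.
  by rewrite tensDr !linearP.
rewrite linfunE ?tliftE // => a x y; apply/lfunP => t.
rewrite add_lfunE scale_lfunE.
pose F v0 := fun w (phi : dual U) => phi (f (tens v0 w)).
apply: (@tlift_param V W (dual U) R^o F) => // w0 p c x' y'.
by rewrite /F tensDl !linearP.
Qed.

Definition tensE_rules := (comp_lfunE, id_lfunE, tensor_mapE, tensor_assocE, tensor_assoc_invE,
  tensor_lunitE, tensor_runitE, tensor_braidE, dual_mapE, tensor_curryE).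

Lemma FVec_assoc_iso U V W : @is_iso FVec_cat _ _ (tensor_assoc U V W).
Proof.
exists (tensor_assoc_inv U V W); split.
  by apply: (@tens_ext3l U V W) => u v w; rewrite /= !tensE_rules.
by apply: (@tens_ext3r U V W) => u v w; rewrite /= !tensE_rules.
Qed.

Lemma tens_scale V W (v : V) (w : W) a : tens (a *: v) w = tens v (a *: w).
Proof.
apply/lfunP => phi; rewrite !tensE (linear_scale_fun a w (hom_linear phi)).
by rewrite scalerA mulrC.
Qed.

Lemma FVec_lunit_iso V : @is_iso FVec_cat _ _ (tensor_lunit V).
Proof.
have l : linear (fun v : V => tens (1 : R^o) v) by move=> a x y; rewrite tensDr.
exists (linfun (fun v : V => tens (1 : R^o) v)); split.
  apply: tens_ext => a v; rewrite /= !tensE_rules (linfunE l) -tens_scale.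
  by congr tens; exact: mulr1.
by apply/lfunP => v; rewrite /= !tensE_rules (linfunE l) tensE_rules scale1r.
Qed.

Lemma FVec_runit_iso V : @is_iso FVec_cat _ _ (tensor_runit V).
Proof.
have l : linear (fun v : V => tens v (1 : R^o)) by move=> a x y; rewrite tensDl.
exists (linfun (fun v : V => tens v (1 : R^o))); split.
  apply: tens_ext => v a; rewrite /= !tensE_rules (linfunE l) tens_scale.
  by congr tens; exact: mulr1.
by apply/lfunP => v; rewrite /= !tensE_rules (linfunE l) tensE_rules scale1r.
Qed.

Lemma tens_ext4 U V W X Y (f g : 'Hom(tensor (tensor (tensor U V) W) X, Y)) :
  (forall u v w x, f (tens (tens (tens u v) w) x) =
                   g (tens (tens (tens u v) w) x)) -> f = g.
Proof.
move=> fg; apply: tens_ext3l => t w x; rewrite (tens_sum t).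
have lw := (@tens_bilin (tensor U V) W).2 w.
have lx := (@tens_bilin (tensor (tensor U V) W) X).2 x.
rewrite (linear_sum_fun _ _ _ lw) (linear_sum_fun _ _ _ lx) !linear_sum.
by apply: eq_bigr => j _; exact: fg.
Qed.

Definition FVec_sym : sym_monoidal.
Proof.
apply: (@SymMonoidal FVec_cat tensor tensor_map (R^o : vectType R)
  tensor_assoc tensor_lunit tensor_runit tensor_braid).
- by move=> V W; apply: tens_ext => v w; rewrite /= !tensE_rules.
- move=> V V' V'' W W' W'' f' f g' g.
  by apply: tens_ext => v w; rewrite /= !tensE_rules.
- exact: FVec_assoc_iso.
- exact: FVec_lunit_iso.
- exact: FVec_runit_iso.
- move=> U U' V V' W W' f g h.
  by apply: (@tens_ext3l U V W) => u v w; rewrite /= !tensE_rules.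
- by move=> V V' f; apply: tens_ext => a v; rewrite /= !tensE_rules linearZ.
- by move=> V V' f; apply: tens_ext => v a; rewrite /= !tensE_rules linearZ.
- by move=> V V' W W' f g; apply: tens_ext => v w; rewrite /= !tensE_rules.
- by move=> U V W X; apply: (@tens_ext4 U V W X) => u v w x; rewrite /= !tensE_rules.
- by move=> V W; apply: (@tens_ext3l V R^o W) => v a w; rewrite /= !tensE_rules tens_scale.
- by move=> U V W; apply: (@tens_ext3l U V W) => u v w; rewrite /= !tensE_rules.
- by move=> V W; apply: tens_ext => v w; rewrite /= !tensE_rules.
Defined.

Lemma dual_map1 V : dual_map (\1%VF : 'Hom(V, V)) = \1%VF.
Proof. by apply/lfunP => p; apply/lfunP => v; rewrite !tensE_rules. Qed.

Lemma dual_map_comp V W U (g : 'Hom(W, U)) (f : 'Hom(V, W)) :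
  dual_map (g \o f)%VF = (dual_map f \o dual_map g)%VF.
Proof. by apply/lfunP => p; apply/lfunP => v; rewrite !tensE_rules. Qed.

Lemma dual_sep W (x y : W) : (forall phi : dual W, phi x = phi y) -> x = y.
Proof.
move=> xy; rewrite (ebasis_sum x) (ebasis_sum y).
by apply: eq_bigr => j _; rewrite xy.
Qed.

Lemma dual_map_bij V W : bijective (@dual_map V W).
Proof.
pose inv (g : 'Hom(dual W, dual V)) : 'Hom(V, W) :=
  linfun (fun v => \sum_j g (edual j) v *: ebasis j).
have invE g v : inv g v = \sum_j g (edual j) v *: ebasis j.
  rewrite linfunE // => a x y; rewrite scaler_sumr -big_split.
  by apply: eq_bigr => j _; rewrite linearP scalerDl -scalerA.
exists inv => [f|g].
  apply/lfunP => v; rewrite invE [RHS]ebasis_sum.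
  by apply: eq_bigr => j _; rewrite dual_mapE.
apply/lfunP => phi; apply/lfunP => v.
rewrite dual_mapE invE {2}(edual_sum phi) !linear_sum sum_lfunE.
by apply: eq_bigr => j _; rewrite !linearZ scale_lfunE; exact: mulrC.
Qed.

Lemma tensor_curry_bij V W U : bijective (@tensor_curry V W U).
Proof.
pose inv (g : 'Hom(V, dual (tensor W (dual U)))) : 'Hom(tensor V W, U) :=
  tlift (fun v w => \sum_j g v (tens w (edual j)) *: ebasis j).
have invE g v w :
    inv g (tens v w) = \sum_j g v (tens w (edual j)) *: ebasis j.
  apply: tliftE; split=> [v0|w0] a x y; rewrite scaler_sumr -big_split;
    apply: eq_bigr => j _.
    by rewrite tensDl linearP scalerDl -scalerA.
  by rewrite linearP add_lfunE scale_lfunE scalerDl -scalerA.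
exists inv => [f|g].
  apply: tens_ext => v w; rewrite invE [RHS]ebasis_sum.
  by apply: eq_bigr => j _; rewrite tensor_curryE.
apply/lfunP => v; apply: tens_ext => w phi; rewrite tensor_curryE invE.
have lw := (@tens_bilin W (dual U)).1 w.
rewrite {2}(edual_sum phi) (linear_sum_fun _ _ _ lw) !linear_sum.
apply: eq_bigr => j _; rewrite (linear_scale_fun _ _ lw) !linearZ.
exact: mulrC.
Qed.

Definition FVec : star_autonomous.
Proof.
apply: (@StarAutonomous FVec_sym dual dual_map dual_map1 _ dual_map_bij
  tensor_curry tensor_curry_bij).
- by move=> V W U g f; exact: dual_map_comp.
- move=> V' V W U f h; apply/lfunP => v; apply: tens_ext => w p.
  by rewrite /= !tensE_rules.
- move=> V W' W U f h; apply/lfunP => v; apply: tens_ext => w p.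
  by rewrite /= !tensE_rules.
- move=> V W U U' f h; apply/lfunP => v; apply: tens_ext => w p.
  by rewrite /= !tensE_rules.
Defined.

Definition convex_cone V (C : set V) :=
  [/\ C 0, forall x y, C x -> C y -> C (x + y)
    & forall (a : R) x, 0 <= a -> C x -> C (a *: x)].

(* A [vectType] carries no topology: it is given the one of its coordinate
   space 'rV[R]_n, transported along the linear isomorphism [v2r]. *)
Definition vclosed V (C : set V) := closed (v2r @` C).
Definition vclosure V (C : set V) : set V := v2r @^-1` closure (v2r @` C).

Definition closed_convex_cone V (C : set V) := convex_cone C /\ vclosed C.

Definition conic_hull V (A : set V) : set V :=
  [set x | exists n (a : 'I_n -> R) (y : 'I_n -> V),
     (forall i, 0 <= a i /\ A (y i)) /\ x = \sum_i a i *: y i].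

Definition closed_conic_hull V (A : set V) : set V := vclosure (conic_hull A).

Definition dual_cone V (C : set V) : set (dual V) :=
  [set phi | forall x, C x -> (0 : R) <= phi x].

Definition min_tensor V W (C : set V) (D : set W) : set (tensor V W) :=
  [set t | exists n (c : 'I_n -> V) (d : 'I_n -> W),
     (forall i, C (c i) /\ D (d i)) /\ t = \sum_i tens (c i) (d i)].

(* The canonical isomorphism V ⊗ W = (V' ⊗ W')', the form of the
   identification V'' = V used in the definition of [max_tensor]. *)
Definition tensor_bidual V W :
    'Hom(tensor V W, dual (tensor (dual V) (dual W))) :=
  tlift (fun v w =>
    tlift (fun (phi : dual V) (psi : dual W) => (phi v * psi w : R) : R^o)).

Lemma tensor_bidualE V W (v : V) (w : W) (phi : dual V) (psi : dual W) :
  tensor_bidual V W (tens v w) (tens phi psi) = (phi v * psi w : R).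
Proof.
pose F v w (phi : dual V) (psi : dual W) := (phi v * psi w : R) : R^o.
have b v0 w0 : bilin (F v0 w0).
  split=> [p|p] a x y; rewrite /F add_lfunE scale_lfunE.
    by rewrite mulrDr; congr (_ + _); exact: mulrCA.
  by rewrite mulrDl; congr (_ + _); rewrite -[LHS]mulrA.
rewrite (_ : tensor_bidual V W _ = tlift (F v w)); first exact: (tliftE phi psi).
apply: (@tliftE V W (dual (tensor (dual V) (dual W))) (fun v w => tlift (F v w))).
split=> [v0|w0] a x y; apply: tens_ext => p q; rewrite add_lfunE scale_lfunE;
  rewrite !(tliftE p q (b _ _)) /F.
  by rewrite linearP mulrDr; congr (_ + _); exact: mulrCA.
by rewrite linearP mulrDl; congr (_ + _); rewrite -[LHS]mulrA.
Qed.

Lemma tensor_bidual_bij V W : bijective (tensor_bidual V W).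
Proof.
pose inv (om : dual (tensor (dual V) (dual W))) : tensor V W :=
  \sum_j tens (\sum_i om (tens (edual i) (edual j)) *: ebasis i) (ebasis j).
have pairE t (phi : dual V) (psi : dual W) :
    tensor_bidual V W t (tens phi psi) = phi (t psi).
  rewrite [in LHS](tens_sum t) linear_sum sum_lfunE.
  rewrite [in RHS](edual_sum psi) !linear_sum; apply: eq_bigr => j _.
  by rewrite [LHS]tensor_bidualE !linearZ; exact: mulrC.
have invE om (phi : dual V) (psi : dual W) :
    phi (inv om psi) = om (tens phi psi).
  rewrite /inv sum_lfunE linear_sum.
  rewrite [in RHS](edual_sum psi).
  rewrite (linear_sum_fun _ _ _ ((tens_bilin (dual V) (dual W)).1 phi)).
  rewrite !linear_sum; apply: eq_bigr => j _.
  rewrite tensE [LHS]linearZ.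
  rewrite (linear_scale_fun _ _ ((tens_bilin (dual V) (dual W)).1 phi)).
  rewrite [RHS]linearZ; congr (_ * _); rewrite linear_sum.
  rewrite [in RHS](edual_sum phi).
  rewrite (linear_sum_fun _ _ _ ((tens_bilin (dual V) (dual W)).2 (edual j))).
  rewrite linear_sum; apply: eq_bigr => i _.
  rewrite (linear_scale_fun _ _ ((tens_bilin (dual V) (dual W)).2 (edual j))).
  by rewrite !linearZ; exact: mulrC.
exists inv => [t|om].
  apply/lfunP => psi; apply: dual_sep => phi.
  by rewrite invE pairE.
by apply: tens_ext => phi psi; rewrite pairE invE.
Qed.

Definition max_tensor V W (C : set V) (D : set W) : set (tensor V W) :=
  tensor_bidual V W @^-1` dual_cone (min_tensor (dual_cone C) (dual_cone D)).

Section Stem.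
Variable C : star_autonomous.

Definition stem := star_functor C FVec.

Variable S : stem.

Definition sob (c : C) : vectType R := fob S c.
Definition smor (c d : C) (f : mor c d) : 'Hom(sob c, sob d) := fmor S f.

(* The element 1 under S(1) = R. *)
Definition sone : sob 𝟏 := (feps S : 'Hom(R^o, sob 𝟏)) (1 : R).

(* The identification S(1^* ) = S(1)' = R' = R. *)
Definition sunit_star : 'Hom(sob (star 𝟏), R^o) :=
  (linfun (fun phi : dual R^o => phi (1 : R))
    \o dual_map (feps S : 'Hom(R^o, sob 𝟏))
    \o (fdelta S 𝟏 : 'Hom(sob (star 𝟏), dual (sob 𝟏))))%VF.

Definition intrinsic_cone (c : C) : set (sob c) :=
  [set v | forall phi : mor c (star 𝟏), (0 : R) <= sunit_star (smor phi v)].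

Definition cointrinsic_cone (c : C) : set (sob c) :=
  closed_conic_hull [set smor Phi sone | Phi in [set: mor 𝟏 c]].

Section System.
Variable X : vectType R.

Definition cone_family := forall c : C, set (tensor X (sob c)).
Implicit Types (G E : cone_family) (D : set X).

Definition is_system G :=
  (forall c, closed_convex_cone (G c)) /\
  (forall (c d : C) (Phi : mor c d),
     tensor_map \1%VF (smor Phi) @` G c `<=` G d).

Definition subfamily G E := forall c, G c `<=` E c.

(* X = X ⊗ S(1) and X ⊗ S(1^* ) = X *)
Definition at_unit (x : X) : tensor X (sob 𝟏) := tens x sone.
Definition from_unit_star : 'Hom(tensor X (sob (star 𝟏)), X) :=
  (tensor_runit X \o tensor_map \1%VF sunit_star)%VF.

Definition contains_at_unit D G := at_unit @` D `<=` G 𝟏.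
Definition contained_at_unit_star D G := from_unit_star @` G (star 𝟏) `<=` D.

Definition min_system D : cone_family :=
  fun c => min_tensor D (@cointrinsic_cone c).
Definition max_system D : cone_family :=
  fun c => max_tensor D (@intrinsic_cone c).

End System.
End Stem.
End FVec.

Arguments sob {R C} S c.
Arguments smor {R C} S {c d} f.
Arguments sone {R C} S.
Arguments sunit_star {R C} S.
Arguments intrinsic_cone {R C} S c _ : rename.
Arguments cointrinsic_cone {R C} S c _ : rename.
Arguments cone_family {R C} S X.
Arguments is_system {R C S X} G.
Arguments subfamily {R C S X} G E.
Arguments contains_at_unit {R C S X} D G.
Arguments contained_at_unit_star {R C S X} D G.
Arguments at_unit {R C} S {X} x.
Arguments from_unit_star {R C} S {X}.
Arguments min_system {R C} S {X} D c _ : rename.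
Arguments max_system {R C} S {X} D c _ : rename.

(* Main.v *)
From HB Require Import structures.
Require Import Defs.
From mathcomp Require Import all_boot all_order all_algebra.
From mathcomp Require Import all_classical all_reals all_analysis.
From mathcomp Require Import ring lra.
Set Implicit Arguments.
Unset Strict Implicit.
Unset Printing Implicit Defensive.
Import Order.TTheory GRing.Theory Num.Theory.
Import numFieldNormedType.Exports VectorInternalTheory.
Local Open Scope classical_set_scope.
Local Open Scope ring_scope.

(** Both extremality claims are formal; the analytic content lies in two facts
    about closed convex cones of finite-dimensional spaces.

    Part (i).  Every element of the cointrinsic cone B(c) is a limit of conic
    combinations of vectors S(Phi)(1), and functoriality of a system G that
    contains x at the unit puts each x ⊗ S(Phi)(1) into G(c).  Since G(c) is a
    closed convex cone, it contains x ⊗ b for all b in B(c), hence all of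
    D ⊗ B(c).  What has to be proved about the family c |-> D ⊗ B(c) itself is
    that its members are closed: [vclosed_min_tensor].  The product
    of any two closed convex cones K and L is closed, even if they contain
    lines.  In the pointed case each cone carries a functional that is strictly
    positive away from 0; normalizing one tensor factor by its functional, and
    bounding the number of summands by Carathéodory's argument, exhibits each
    sublevel set of the product functional inside a compact subset of the
    tensor product.  In general, let p and q be projections that kill the
    lineality spaces of K and L.  Then t is in K ⊗ L if and only if (p ⊗ q) t
    is in the tensor product of the pointed parts and t - (p ⊗ q) t in the
    lineality space of K ⊗ L; both conditions are closed.

    Part (ii).  The cone D ⊗ A(c) (maximal tensor product) consists of the t
    with (phi ⊗ psi)(t) >= 0 for phi in the dual of D and psi in the dual of
    A(c), so it is closed by construction.  If t lies in G(c) and phi is in the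
    dual of D, then contracting t with phi gives a vector v of S(c); pushing t
    forward to the dual unit along f : c -> 1^* shows that every S(f) is
    nonnegative at v, that is, v lies in A(c), whence psi(v) >= 0.
    Containment in D at the dual unit is the bipolar theorem [bipolar] for D,
    because the canonical functional on S(1^* ) is in the dual of A(1^* ). *)

Section Cones.
Variable R : realType.
Implicit Types U V W X : vectType R.

(** * Bilinearity and evaluation of tensors *)

Lemma tensZl V W a (v : V) (w : W) : tens (a *: v) w = a *: tens v w.
Proof. exact: (linear_scale_fun _ _ ((tens_bilin V W).2 w)). Qed.

Lemma tensBl V W (v v' : V) (w : W) : tens (v - v') w = tens v w - tens v' w.
Proof. by rewrite -scaleN1r addrC tensDl scaleN1r addrC. Qed.

Lemma tensBr V W (v : V) (w w' : W) : tens v (w - w') = tens v w - tens v w'.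
Proof. by rewrite -scaleN1r addrC tensDr scaleN1r addrC. Qed.

Lemma tensNl V W (v : V) (w : W) : tens (- v) w = - tens v w.
Proof. by rewrite -scaleN1r tensZl scaleN1r. Qed.

Lemma tensNr V W (v : V) (w : W) : tens v (- w) = - tens v w.
Proof. by rewrite -scaleN1r -tens_scale tensZl scaleN1r. Qed.

(** The model V ⊗ W = Lin(W', V) makes contraction with a functional on W mere
    application, and here is how it interacts with maps. *)
Lemma tensor_map_app V V' W W' (f : 'Hom(V, V')) (g : 'Hom(W, W'))
    (t : tensor V W) (psi : dual W') :
  tensor_map f g t psi = f (t (dual_map g psi)).
Proof.
rewrite {1}(tens_sum t) (linear_sum_fun _ _ _ (hom_linear _)) sum_lfunE.
rewrite [in RHS](edual_sum (dual_map g psi)) !(linear_sum_fun _ _ _ (hom_linear _)).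
apply: eq_bigr => j _.
rewrite tensor_mapE tensE dual_mapE.
by rewrite !(linear_scale_fun _ _ (hom_linear _)).
Qed.

Lemma tensor_runit_app V (t : tensor V R^o) : tensor_runit V t = t \1%VF.
Proof.
rewrite (tens_sum t) (linear_sum_fun _ _ _ (hom_linear _)) sum_lfunE.
by apply: eq_bigr => j _; rewrite tensor_runitE tensE id_lfunE.
Qed.

(** Contracting the first factor of t with phi takes phi o t : W' -> R to a
    vector of W, by W'' = W. *)
Lemma contract_left V W (phi : dual V) (t : tensor V W) :
  exists v : W, forall psi : dual W, psi v = phi (t psi).
Proof.
exists (\sum_j (phi (t (edual j)) : R) *: ebasis j) => psi.
rewrite [in RHS](edual_sum psi) !(linear_sum_fun _ _ _ (hom_linear _)).
apply: eq_bigr => j _; rewrite !(linear_scale_fun _ _ (hom_linear _)).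
exact: mulrC.
Qed.

Lemma tensor_bidual_app V W (t : tensor V W) phi psi :
  tensor_bidual V W t (tens phi psi) = phi (t psi).
Proof.
rewrite [in LHS](tens_sum t) linear_sum sum_lfunE.
rewrite [in RHS](edual_sum psi) !linear_sum; apply: eq_bigr => j _.
by rewrite [LHS]tensor_bidualE !linearZ; exact: mulrC.
Qed.

(** * Continuity and closedness in finite-dimensional spaces *)

Lemma continuous_lincomb (T : topologicalType) (E : normedModType R)
    (I : finType) (a : I -> T -> R) (e : I -> E) :
  (forall i, continuous (a i)) -> continuous (fun t => \sum_i a i t *: e i).
Proof.
move=> ca; apply: continuous_big => [|i _]; first exact: add_continuous.
by move=> t; apply: cvgZr_tmp; exact: ca.
Qed.

Lemma rV_linear_continuous n (E : normedModType R) (f : 'rV[R]_n -> E) :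
  linear f -> continuous f.
Proof.
move=> lf.
pose g : {linear 'rV[R]_n -> E} := HB.pack f (GRing.isLinear.Build R _ _ _ f lf).
rewrite (_ : f = fun x => \sum_i x 0 i *: f (delta_mx 0 i)).
  by apply: continuous_lincomb => i; exact: coord_continuous.
apply/funext => x; rewrite {1}(row_sum_delta x) -[LHS]/(g _) linear_sum.
by apply: eq_bigr => i _; rewrite linearZ.
Qed.

Lemma hom_continuous V W (f : 'Hom(V, W)) : continuous (v2r \o f \o r2v).
Proof. by apply: rV_linear_continuous => a x y /=; rewrite !linearP. Qed.

Lemma form_continuous V (f : dual V) :
  continuous ((f : V -> R) \o r2v : 'rV[R]_(dim V) -> R).
Proof. by apply: (@rV_linear_continuous _ R^o) => a x y /=; rewrite !linearP. Qed.

Lemma vclosedE V (A : set V) : vclosed A = closed (r2v @^-1` A).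
Proof.
congr closed; apply/seteqP; split=> [_ [x Ax <-]|y Ay] /=; first by rewrite v2rK.
by exists (r2v y) => //; rewrite r2vK.
Qed.

Lemma vclosed_preimage V W (f : V -> W) (A : set W) :
  continuous (v2r \o f \o r2v) -> vclosed A -> vclosed (f @^-1` A).
Proof.
move=> cf; rewrite !vclosedE => cA.
have -> : r2v @^-1` (f @^-1` A) = (v2r \o f \o r2v) @^-1` (r2v @^-1` A).
  by apply/seteqP; split=> y /=; rewrite v2rK.
by apply: closed_comp => // y _; exact: cf.
Qed.

Lemma vclosed_preimage_hom V W (f : 'Hom(V, W)) (A : set W) :
  vclosed A -> vclosed (f @^-1` A).
Proof. by apply: vclosed_preimage; exact: hom_continuous. Qed.

Lemma vclosed_translate V (c : V) (A : set V) :
  vclosed A -> vclosed (+%R c @^-1` A).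
Proof.
apply: vclosed_preimage => y.
rewrite (_ : v2r \o +%R c \o r2v = fun y => v2r c + y); last first.
  by apply/funext => z /=; rewrite linearD /= r2vK.
apply: (continuousD (f := cst (v2r c)) (g := id)); first exact: cst_continuous.
by move=> B.
Qed.

Lemma vclosedI V (A B : set V) : vclosed A -> vclosed B -> vclosed (A `&` B).
Proof. by rewrite !vclosedE => cA cB; exact: closedI. Qed.

Lemma vclosed_bigcap V I (P : set I) (F : I -> set V) :
  (forall i, P i -> vclosed (F i)) -> vclosed (\bigcap_(i in P) F i).
Proof.
move=> cF; rewrite vclosedE preimage_bigcap.
by apply: closed_bigI => i Pi; rewrite -vclosedE; exact: cF.
Qed.

Lemma vclosed_form_ge0 V (phi : dual V) : vclosed [set x | (0 : R) <= phi x].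
Proof.
rewrite vclosedE; apply: (@closed_comp _ _ ((phi : V -> R) \o r2v) [set z | 0 <= z]).
  by move=> y _; exact: form_continuous.
exact: closed_ge.
Qed.

Lemma vclosed_set0 V : vclosed [set (0 : V)].
Proof.
rewrite /vclosed image_set1.
by apply: compact_closed; [exact: norm_hausdorff | exact: compact_set1].
Qed.

(** A subspace is the kernel of a linear map, namely of the complementary
    projection. *)
Lemma vclosed_vspace V (L : {vspace V}) : vclosed [set x | x \in L].
Proof.
rewrite (_ : mkset _ = (\1 - projv L)%VF @^-1` [set 0]).
  exact/vclosed_preimage_hom/vclosed_set0.
apply/seteqP; split=> x /=; rewrite add_lfunE opp_lfunE id_lfunE.
  by move=> xL; rewrite projv_id // subrr.
by move/eqP; rewrite subr_eq0 => /eqP ->; exact: memv_proj.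
Qed.

Lemma sub_vclosure V (A : set V) : A `<=` vclosure A.
Proof. by move=> x Ax; apply: subset_closure; exists x. Qed.

Lemma vclosed_vclosure V (A : set V) : vclosed (vclosure A).
Proof.
rewrite vclosedE (_ : r2v @^-1` _ = closure (v2r @` A)); first exact: closed_closure.
by apply/seteqP; split=> y /=; rewrite /vclosure /= r2vK.
Qed.

Lemma vclosure_min V (A B : set V) : A `<=` B -> vclosed B -> vclosure A `<=` B.
Proof.
move=> AB cB x clx.
have [y By /v2r_inj <-//] : (v2r @` B) (v2r x).
by apply: cB; apply: closureS clx; exact: image_subset.
Qed.

(** For sums, minimality of the closure is used twice, freeing one summand at a
    time: first A + cl A, then cl A + cl A, is contained in cl A. *)
Lemma convex_cone_vclosure V (A : set V) :
  convex_cone A -> convex_cone (vclosure A).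
Proof.
move=> [A0 AD AZ]; have cA := vclosed_vclosure (A := A).
split; first exact: sub_vclosure.
- have stepl x : A x -> vclosure A `<=` +%R x @^-1` vclosure A.
    move=> Ax; apply: vclosure_min; last exact: vclosed_translate.
    by move=> y Ay; apply/sub_vclosure/AD.
  move=> x y clx; move: y.
  suff: vclosure A `<=` +%R x @^-1` vclosure A by apply.
  apply: vclosure_min; last exact: vclosed_translate.
  by move=> y Ay /=; rewrite addrC; exact: stepl.
- move=> a x a0; move: x.
  have h y : (a *: \1 : 'End(V))%VF y = a *: y by rewrite scale_lfunE id_lfunE.
  suff: vclosure A `<=` (a *: \1 : 'End(V))%VF @^-1` vclosure A.
    by move=> + x clx => /(_ x clx) /=; rewrite h.
  apply: vclosure_min; last exact: vclosed_preimage_hom.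
  by move=> y Ay /=; rewrite h; apply/sub_vclosure/AZ.
Qed.

Lemma tens_continuous V W :
  continuous (fun p : 'rV[R]_(dim V) * 'rV[R]_(dim W) =>
    v2r (tens (r2v p.1 : V) (r2v p.2 : W))).
Proof.
pose a (k : 'I_(dim V) * 'I_(dim W)) (p : 'rV[R]_(dim V) * 'rV[R]_(dim W)) :=
  p.1 0 k.1 * p.2 0 k.2.
pose e (k : 'I_(dim V) * 'I_(dim W)) :=
  v2r (tens (r2v (delta_mx 0 k.1) : V) (r2v (delta_mx 0 k.2) : W)).
have ca k : continuous (a k).
  move=> p; apply: cvgM.
    apply: (@continuous_comp _ _ _ fst (fun M : 'rV[R]_(dim V) => M 0 k.1)).
      exact: cvg_fst.
    exact: coord_continuous.
  apply: (@continuous_comp _ _ _ snd (fun M : 'rV[R]_(dim W) => M 0 k.2)).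
    exact: cvg_snd.
  exact: coord_continuous.
rewrite (_ : (fun p => _) = fun p => \sum_k a k p *: e k).
  exact: (continuous_lincomb (e := e) ca).
apply/funext => -[x y] /=.
rewrite -(pair_bigA _ (fun i j => a (i, j) (x, y) *: e (i, j))) /=.
rewrite {1}(row_sum_delta x) {1}(row_sum_delta y) !linear_sum.
rewrite (linear_sum_fun _ _ _ ((tens_bilin V W).2 _)) linear_sum.
apply: eq_bigr => i _.
rewrite (linear_sum_fun _ _ _ ((tens_bilin V W).1 _)) linear_sum.
apply: eq_bigr => j _.
rewrite !linearZ (linear_scale_fun _ _ ((tens_bilin V W).1 _)) linearZ /=.
by rewrite tensZl linearZ scalerA mulrC.
Qed.

(** * Convex cones and finite sums *)

(** Conic hulls and minimal tensor products are both unions of these sets over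
    n, for Q stable under scaling; keeping n apart is what allows bounding it
    by the dimension. *)
Definition sums V (Q : set V) n : set V :=
  [set x | exists2 y : 'I_n -> V, forall i, Q (y i) & x = \sum_i y i].

Lemma convex_cone_sums V (Q : set V) :
  (forall (a : R) x, 0 <= a -> Q x -> Q (a *: x)) ->
  convex_cone (\bigcup_n sums Q n).
Proof.
move=> QZ; split.
- by exists 0%N => //; exists (fun=> 0) => [[]//|]; rewrite big_ord0.
- move=> _ _ [m _ [x Qx ->]] [n _ [y Qy ->]]; exists (m + n)%N => //.
  exists (fun i : 'I_(m + n) => match fintype.split i with inl j => x j | inr j => y j end).
    by move=> i; case: (fintype.split i) => j; [exact: Qx | exact: Qy].
  rewrite big_split_ord /=; congr (_ + _); apply: eq_bigr => i _.
    by rewrite (unsplitK (inl i)).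
  by rewrite (unsplitK (inr i)).
- move=> a _ a0 [m _ [x Qx ->]]; exists m => //; exists (fun i => a *: x i).
    by move=> i; exact: QZ.
  by rewrite scaler_sumr.
Qed.

Lemma conic_hullE V (A : set V) :
  conic_hull A = \bigcup_n sums [set x | exists2 a : R, 0 <= a &
    exists2 y, A y & x = a *: y] n.
Proof.
apply/seteqP; split=> [_ [n [a [y [ay ->]]]]|_ [n _ [z Qz ->]]].
  by exists n => //; exists (fun i => a i *: y i) => // i; have [a0 Ay] := ay i;
    exists (a i) => //; exists (y i).
have /choice[k Hk] : forall i, exists k : R * V, [/\ 0 <= k.1, A k.2 & z i = k.1 *: k.2].
  by move=> i; have [a a0 [y Ay ->]] := Qz i; exists (a, y).
exists n, (fun i => (k i).1), (fun i => (k i).2).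
by split=> [i|]; [have [] := Hk i | apply: eq_bigr => i _; have [] := Hk i].
Qed.

Lemma convex_cone_conic_hull V (A : set V) : convex_cone (conic_hull A).
Proof.
rewrite conic_hullE; apply: convex_cone_sums => a _ a0 [b b0 [y Ay ->]].
by exists (a * b); [exact: mulr_ge0 | exists y; rewrite ?scalerA].
Qed.

Lemma convex_cone_sum V (A : set V) I (r : seq I) (F : I -> V) :
  convex_cone A -> (forall i, A (F i)) -> A (\sum_(i <- r) F i).
Proof. by move=> [A0 AD _] AF; elim/big_rec: _ => // i x _; exact: AD. Qed.

Lemma conic_hull_min V (A B : set V) :
  convex_cone B -> A `<=` B -> conic_hull A `<=` B.
Proof.
move=> cB AB _ [n [a [y [ay ->]]]]; apply: convex_cone_sum => // i.
by case: cB => _ _ BZ; have [a0 /AB By] := ay i; exact: BZ.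
Qed.

Lemma sub_conic_hull V (A : set V) : A `<=` conic_hull A.
Proof.
move=> x Ax; exists 1%N, (fun=> 1), (fun=> x); split=> [_|]; first by rewrite ler01.
by rewrite big_ord1 scale1r.
Qed.

Lemma closed_convex_coneI V (A B : set V) :
  closed_convex_cone A -> closed_convex_cone B -> closed_convex_cone (A `&` B).
Proof.
move=> [[A0 AD AZ] cA] [[B0 BD BZ] cB]; split; last exact: vclosedI.
split=> //; first by move=> x y [? ?] [? ?]; split; [exact: AD|exact: BD].
by move=> a x a0 [? ?]; split; [exact: AZ|exact: BZ].
Qed.

Lemma closed_convex_cone_preimage V W (f : 'Hom(V, W)) (A : set W) :
  closed_convex_cone A -> closed_convex_cone (f @^-1` A).
Proof.
move=> [[A0 AD AZ] cA]; split; last exact: vclosed_preimage_hom.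
split; first by rewrite /= linear0.
  by move=> x y /= Ax Ay; rewrite linearD; exact: AD.
by move=> a x a0 /= Ax; rewrite linearZ; exact: AZ.
Qed.

Lemma closed_convex_cone0 V : closed_convex_cone [set (0 : V)].
Proof.
split; last exact: vclosed_set0.
by split=> //= [x y -> ->|a x _ ->]; rewrite ?addr0 ?scaler0.
Qed.

Lemma closed_convex_cone_dual V (A : set V) : closed_convex_cone (dual_cone A).
Proof.
split; first split.
- by move=> x Ax; rewrite zero_lfunE.
- by move=> f g Af Ag x Ax; rewrite add_lfunE addr_ge0 // ?Af ?Ag.
- by move=> a f a0 Af x Ax; rewrite scale_lfunE; apply: mulr_ge0 => //; exact: Af.
- pose ev x : dual (dual V) := linfun (fun phi : dual V => phi x).
  have evE x phi : ev x phi = phi x.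
    by rewrite linfunE // => a f g; rewrite add_lfunE scale_lfunE.
  rewrite (_ : dual_cone A = \bigcap_(x in A) [set phi | (0 : R) <= ev x phi]).
    by apply: vclosed_bigcap => x _; exact: vclosed_form_ge0.
  by apply/seteqP; split=> phi Aphi x Ax /=; [rewrite evE|rewrite -evE]; exact: Aphi.
Qed.

(** * Nearest points and the bipolar theorem *)

Lemma compact_box n (M : R) :
  compact [set x : 'rV[R]_n | forall i, `|x 0 i| <= M].
Proof.
rewrite (_ : mkset _ = [set x : 'rV[R]_n | forall i, `[- M, M]%classic (x 0 i)]).
  by apply: (@rV_compact R n (fun=> `[- M, M]%classic)) => i; exact: segment_compact.
by apply/seteqP; split=> x /= H i; have := H i; rewrite in_itv /= ler_norml.
Qed.

Definition dot n (u v : 'rV[R]_n) : R := \sum_i u 0 i * v 0 i.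

Lemma dotC n (u v : 'rV[R]_n) : dot u v = dot v u.
Proof. by apply: eq_bigr => i _; rewrite mulrC. Qed.

Lemma dot_linear n (u : 'rV[R]_n) a x y : dot u (a *: x + y) = a * dot u x + dot u y.
Proof.
rewrite /dot mulr_sumr -big_split; apply: eq_bigr => i _ /=.
by rewrite !mxE mulrDr mulrCA.
Qed.

Lemma sqr_coord_le_dot n (u : 'rV[R]_n) i : u 0 i ^+ 2 <= dot u u.
Proof.
rewrite /dot (bigD1 i) //= -expr2 lerDl; apply: sumr_ge0 => j _.
by rewrite -expr2 sqr_ge0.
Qed.

Lemma dot_gt0 n (u : 'rV[R]_n) : u != 0 -> 0 < dot u u.
Proof.
move=> u0; have [i ui] : exists i, u 0 i != 0.
  apply/existsP; apply: contra_neqT u0; rewrite negb_exists => /forallP h.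
  by apply/rowP => i; rewrite mxE; apply/eqP; have := h i; rewrite negbK.
by apply: lt_le_trans (sqr_coord_le_dot u i); rewrite exprn_even_gt0.
Qed.

Lemma sqdist_continuous n (x : 'rV[R]_n) : continuous (fun y : 'rV[R]_n => dot (y - x) (y - x)).
Proof.
apply: continuous_big => [|i _]; first exact: add_continuous.
have c : continuous (fun y : 'rV[R]_n => y 0 i - x 0 i).
  move=> y; apply: (continuousB (f := fun y : 'rV[R]_n => y 0 i) (g := cst (x 0 i))).
    exact: coord_continuous.
  exact: cst_continuous.
rewrite (_ : (fun y => _) = (fun y : 'rV[R]_n => y 0 i - x 0 i) \* (fun y => y 0 i - x 0 i)).
  by move=> y; apply: continuousM; exact: c.
by apply/funext => y /=; rewrite !mxE.
Qed.

(** It suffices to minimize over the part of K that is at least as close to x as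
    some given point of K, which is compact by Heine-Borel. *)
Lemma nearest_point n (K : set 'rV[R]_n) (x : 'rV[R]_n) : closed K -> K !=set0 ->
  exists2 p, K p & forall y, K y -> dot (p - x) (p - x) <= dot (y - x) (y - x).
Proof.
move=> clK [z Kz]; pose f y := dot (y - x) (y - x).
pose B := K `&` [set y | f y <= f z].
have cB : compact B.
  pose M := f z + 1 + \sum_i `|x 0 i|.
  have clB : closed B.
    apply: closedI => //; apply: (@closed_comp _ _ f [set t | t <= f z]).
      by move=> y _; exact: sqdist_continuous.
    exact: closed_le.
  apply: subclosed_compact clB (@compact_box n M) _.
  move=> y [_ /= fy] i.
  have h1 : `|x 0 i| <= \sum_i `|x 0 i|.
    by rewrite (bigD1 i) //= lerDl; apply: sumr_ge0.
  have h2 : `|(y - x) 0 i| <= f z + 1.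
    have := le_trans (sqr_coord_le_dot (y - x) i) fy.
    (* t ^ 2 <= r forces |t| <= r + 1, which spares a square root. *)
    by rewrite -(real_normK (num_real _)); nra.
  have -> : y 0 i = (y - x) 0 i + x 0 i by rewrite !mxE subrK.
  by apply: le_trans (ler_normD _ _) _; rewrite lerD.
have [||p] := @compact_EVT_min _ R f B _ cB.
- by exists z; split=> //=.
- by apply: continuous_subspaceT => y; exact: sqdist_continuous.
rewrite inE => -[Kp /= fp] Hp; exists p => // y Ky.
have [fy|/ltW fy] := leP (f y) (f z); first by apply: Hp; rewrite inE; split.
exact: le_trans fp fy.
Qed.

(** If x is outside C and p is the nearest point of C, then u = p - x separates:
    moving from p along y in C, or back along p, cannot decrease the distance to
    x, so <u, y> >= 0 on C and <u, p> <= 0, and then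
    <u, x> = <u, p> - <u, u> < 0. *)
Lemma bipolar V (C : set V) (x : V) : closed_convex_cone C ->
  (forall phi, dual_cone C phi -> (0 : R) <= phi x) -> C x.
Proof.
move=> [[C0 CD CZ]]; rewrite vclosedE => clC Hx.
have [|p Cp Hp] := nearest_point (v2r x) clC; first by exists 0; rewrite /= linear0.
have [u0|u0] := eqVneq (p - v2r x) 0.
  by move/eqP: u0; rewrite subr_eq0 => /eqP u0; move: Cp; rewrite /= u0 v2rK.
exfalso; pose u := p - v2r x.
have key y (s : R) : C (r2v (p + s *: y)) -> 0 <= s * dot u y *+ 2 + s ^+ 2 * dot y y.
  move=> /Hp; rewrite -/u (_ : p + s *: y - v2r x = s *: y + u); last first.
    by rewrite addrAC addrC.
  rewrite dot_linear (dotC _ y) (dotC _ u) !dot_linear (dotC y u).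
  rewrite -subr_ge0; set r := (X in 0 <= X -> _).
  by rewrite (_ : r = s * dot u y *+ 2 + s ^+ 2 * dot y y) // /r; ring.
have small (a b : R) : 0 <= b ->
    (forall s : R, 0 < s -> s <= 1 -> 0 <= s * a *+ 2 + s ^+ 2 * b) -> 0 <= a.
  (* For a < 0, the choice s = - a / (b - a) is in ]0, 1] and gives
     2 a + s b < a < 0. *)
  move=> b0 h; rewrite leNgt; apply/negP => a0.
  pose s := - a / (b - a); have ba : 0 < b - a by lra.
  have s0 : 0 < s by rewrite divr_gt0 // oppr_gt0.
  have s1 : s <= 1 by rewrite ler_pdivrMr //; lra.
  have e : s * (b - a) = - a by rewrite divfK // gt_eqF.
  by have := h s s0 s1; nra.
have dd (y : 'rV[R]_(dim V)) : 0 <= dot y y by apply: sumr_ge0 => i _; rewrite -expr2 sqr_ge0.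
have uC y : C y -> 0 <= dot u (v2r y).
  move=> Cy; apply: (small _ _ (dd (v2r y))) => s s0 _; apply: key.
  by rewrite linearD linearZ /= v2rK; apply: CD => //; exact/CZ/Cy/ltW.
have up : dot u p <= 0.
  rewrite -oppr_ge0; apply: (small _ _ (dd p)) => s s0 s1.
  (* Here p - s p is in C because s <= 1. *)
  have := key p (- s); rewrite sqrrN mulNr mulrN => h; apply: h.
  by rewrite scaleNr -{1}[p]scale1r -scalerBl linearZ; apply: CZ => //; rewrite subr_ge0.
have dux : dot u (v2r x) < 0.
  have := dot_linear u (-1) (v2r x) p; rewrite scaleN1r addrC -/u.
  by have := dot_gt0 u0; rewrite -/u; lra.
pose phi : dual V := linfun (fun y => dot u (v2r y) : R^o).
have phiE y : phi y = dot u (v2r y).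
  by rewrite linfunE // => a z t; rewrite linearP dot_linear.
have : dual_cone C phi by move=> y /uC; rewrite phiE.
by move=> /Hx; rewrite phiE leNgt dux.
Qed.

(** * Lineality spaces and strictly positive functionals *)

(** A sequence in A whose span has maximal dimension must span all of A. *)
Lemma spanning_seq V (A : set V) :
  exists s : seq V, (forall x, x \in s -> A x) /\ A `<=` [set x | x \in span s].
Proof.
pose P k := `[< exists s : seq V, (forall x, x \in s -> A x) /\ \dim (span s) = k >].
have exP : exists k, P k by exists (\dim <<[::] : seq V>>); apply/asboolP; exists [::].
have leP k : P k -> (k <= \dim {:V})%N.
  by move=> /asboolP[s [_ <-]]; exact/dimvS/subvf.
case: (ex_maxnP exP leP) => m /asboolP[s [sA dims]] max_m.
exists s; split=> // x Ax /=.
have sub : (span s <= <<x :: s>>)%VS by rewrite span_cons addvSr.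
have : span s == <<x :: s>>%VS.
  rewrite eqEdim sub dims; apply: max_m; apply/asboolP; exists (x :: s).
  by split=> // y; rewrite inE => /predU1P[->//|]; exact: sA.
by move/eqP ->; apply: memv_span; exact: mem_head.
Qed.

Lemma lineality_vspace V (C : set V) : convex_cone C ->
  exists L : {vspace V}, forall x, (x \in L) <-> (C x /\ C (- x)).
Proof.
move=> [C0 CD CZ]; pose A := [set x | C x /\ C (- x)].
have cA : convex_cone A.
  split; first by rewrite /A /= oppr0.
    by move=> x y [Cx Cx'] [Cy Cy']; split; rewrite ?opprD; exact: CD.
  by move=> a x a0 [Cx Cx']; split; rewrite -?scalerN; exact: CZ.
have AZ a x : A x -> A (a *: x).
  case: cA => _ _ AZ Ax; have [|/ltW a0] := leP 0 a; first by move=> *; exact: AZ.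
  rewrite -[a]opprK scaleNr -scalerN; apply: AZ; first by rewrite oppr_ge0.
  by case: Ax => ? ?; split; rewrite ?opprK.
have [s [sA As]] := spanning_seq A; exists (span s) => x; split; last exact: As.
move=> /(@coord_span _ _ _ (in_tuple s)) ->.
by apply: (convex_cone_sum _ cA) => i; apply/AZ/sA/mem_nth.
Qed.

(** The sum of a spanning family of the dual cone C^∨ lies in its relative
    interior: if it vanishes at x in C, then so does each summand, hence all
    of C^∨, and the bipolar theorem puts - x into C. *)
Lemma dual_cone_relint V (C : set V) : closed_convex_cone C ->
  exists2 phi, dual_cone C phi & forall x, C x -> phi x = 0 -> C (- x).
Proof.
move=> clC; have [s [sC Cs]] := spanning_seq (dual_cone C).
have E x : (\sum_(psi <- s) psi) x = \sum_(psi <- s) (psi x : R).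
  exact: sum_lfunE.
exists (\sum_(psi <- s) psi).
  move=> x Cx; rewrite E big_seq_cond; apply: sumr_ge0 => psi /andP[psis _].
  exact: sC.
move=> x Cx; rewrite E => /eqP; rewrite big_seq psumr_eq0; last first.
  by move=> psi psis; exact: sC.
move=> /allP vanish; apply: bipolar clC _ => psi /Cs /= psis.
have -> // : psi (- x) = 0.
rewrite linearN; apply/eqP; rewrite oppr_eq0; apply/eqP.
move: psis => /(@coord_span _ _ _ (in_tuple s)) ->.
have lx : linear (fun f : dual V => f x).
  by move=> a f g; rewrite add_lfunE scale_lfunE.
apply: (etrans (linear_sum_fun _ _ _ lx)); apply: big1 => i _.
apply: (etrans (linear_scale_fun _ _ lx)).
have si : s`_i \in s by apply: mem_nth.
have /implyP/(_ si)/eqP -> := vanish _ si.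
exact: mulr0.
Qed.

(** The projection pi kills the lineality space L of C and changes points of C
    only by elements of L; its fixed points in C form a pointed cone, on which a
    relative interior point of the dual cone is strictly positive. *)
Lemma split_lineality V (C : set V) : closed_convex_cone C ->
  exists pi : 'End(V), exists phi : dual V,
    [/\ forall x, C x -> C (pi x),
        forall x, C x -> C (x - pi x) /\ C (pi x - x),
        closed_convex_cone (C `&` [set x | pi x = x]),
        forall x, C x -> pi (pi x) = pi x
      & forall x, (C `&` [set x | pi x = x]) x -> x != 0 -> (0 : R) < phi x].
Proof.
move=> hC; have [cC clC] := hC.
have [L LP] := lineality_vspace cC; have [phi phiC phi0] := dual_cone_relint hC.
have [C0 CD CZ] := cC.
pose pi : 'End(V) := (\1 - projv L)%VF.
have piE x : pi x = x - projv L x by rewrite /pi add_lfunE opp_lfunE id_lfunE.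
have pL x : C (projv L x) /\ C (- projv L x) by apply/LP; exact: memv_proj.
exists pi, phi; split.
- by move=> x Cx; rewrite piE; apply: CD => //; have [] := pL x.
- by move=> x Cx; rewrite piE opprB addrC subrK addrAC subrr add0r.
- rewrite (_ : mkset _ = projv L @^-1` [set 0]).
    apply: closed_convex_coneI => //.
    by apply: closed_convex_cone_preimage; exact: closed_convex_cone0.
  apply/seteqP; split=> x /=; rewrite piE.
    by move/eqP; rewrite -subr_eq0 addrAC subrr add0r oppr_eq0 => /eqP.
  by move=> ->; rewrite subr0.
- by move=> x _; rewrite !piE linearB /= projv_proj subrr subr0.
- move=> x [Cx pix] x0; rewrite lt_neqAle (phiC x Cx) andbT eq_sym.
  apply: contra_neq x0 => /phi0 => /(_ Cx) Cx'.
  have xL : x \in L by apply/LP.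
  by rewrite -pix /= piE projv_id // subrr.
Qed.

(** * Finite sums of bounded length and compactness *)

Lemma subset_sumsS V (Q : set V) n : Q 0 -> sums Q n `<=` sums Q n.+1.
Proof.
move=> Q0 _ [y Qy ->].
exists (fun i => if unlift ord0 i is Some j then y j else 0).
  by move=> i; case: unliftP => [j _|_].
rewrite big_ord_recl unlift_none add0r.
by apply: eq_bigr => i _; rewrite liftK.
Qed.

(** With more summands than the dimension there is a relation
    sum_i k_i y_i = 0 with some k_i > 0.  Subtracting its multiple by the
    inverse of the largest k_m keeps all coefficients 1 - k_i / k_m nonnegative
    and removes the summand y_m. *)
Lemma sums_caratheodory V (Q : set V) n :
  (forall (a : R) x, 0 <= a -> Q x -> Q (a *: x)) ->
  (\dim {:V} <= n)%N -> sums Q n.+1 `<=` sums Q n.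
Proof.
move=> QZ dimn _ [y Qy ->].
have [k [ky [i ki]]] : exists k : 'I_n.+1 -> R,
    \sum_i k i *: y i = 0 /\ exists i, 0 < k i.
  pose X := [tuple y i | i < n.+1].
  have /(elimN freeP) nX : ~~ free X.
    rewrite /free size_tuple; apply/eqP => dX.
    by have := leq_trans (dimvS (subvf <<X>>)) dimn; rewrite dX ltnn.
  have [k] : exists k : 'I_n.+1 -> R, ~ (\sum_i k i *: y i = 0 -> forall i, k i = 0).
    apply: contrapT => /forallNP h; apply: nX => k Hk.
    have /contrapT := h k; apply; rewrite -[RHS]Hk.
    by apply: eq_bigr => i _; rewrite -tnth_nth tnth_mktuple.
  move=> /not_implyP[ky /existsNP[i /eqP]]; rewrite neq_lt => /orP[ki|ki].
    exists (fun i => - k i); split; last by exists i; rewrite oppr_gt0.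
    apply/eqP; rewrite -oppr_eq0 -sumrN; apply/eqP; rewrite -[RHS]ky.
    by apply: eq_bigr => j _; rewrite scaleNr opprK.
  by exists k; split=> //; exists i.
pose m := [arg max_(j > i) k j]%O.
have km j : k j <= k m by rewrite /m; case: arg_maxP => // m' _; apply.
have km0 : 0 < k m by apply: lt_le_trans ki (km i).
pose z j := (1 - k j / k m) *: y j.
exists (fun j => z (lift m j)).
  move=> j; apply: QZ => //.
  by rewrite subr_ge0 ler_pdivrMr // mul1r.
have -> : \sum_j y j = \sum_j z j.
  have e : (k m)^-1 *: (\sum_i k i *: y i) = 0 by rewrite ky scaler0.
  rewrite -[LHS]subr0 -[X in _ - X]e scaler_sumr -sumrB.
  apply: eq_bigr => j _.
  by rewrite /z scalerBl scale1r scalerA mulrC.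
rewrite (bigD1_ord m) //= {1}/z divff ?gt_eqF // subrr scale0r add0r //.
Qed.

Lemma sums_dim V (Q : set V) n : Q 0 ->
  (forall (a : R) x, 0 <= a -> Q x -> Q (a *: x)) ->
  sums Q n `<=` sums Q (\dim {:V}).
Proof.
move=> Q0 QZ; have [nd|/ltnW] := leqP n (\dim {:V}).
  move=> x Qx; rewrite -(subnKC nd).
  elim: (_ - n)%N => [|k IHk]; first by rewrite addn0.
  by rewrite addnS; exact: subset_sumsS.
move=> /subnKC <-; elim: (n - _)%N => [|k IHk]; first by rewrite addn0.
by rewrite addnS => x /sums_caratheodory; move/(_ QZ (leq_addr _ _)); exact: IHk.
Qed.

Lemma compact_sums V (K : set V) n :
  compact (v2r @` K) -> compact (v2r @` sums K n).
Proof.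
move=> cK; elim: n => [|n IHn].
  rewrite (_ : sums K 0 = [set 0]); first by rewrite image_set1; exact: compact_set1.
  apply/seteqP; split=> [x [y _ ->]|x ->]; rewrite ?big_ord0 //=.
  by exists (fun=> 0) => [[]//|]; rewrite big_ord0.
pose add (p : 'rV[R]_(dim V) * 'rV[R]_(dim V)) := p.1 + p.2.
rewrite (_ : v2r @` _ = add @` ((v2r @` K) `*` (v2r @` sums K n))).
  apply: continuous_compact; last exact: compact_setX.
  by apply: continuous_subspaceT; exact: add_continuous.
apply/seteqP; split=> [_ [_ [y Ky ->] <-]|_ [[_ _] /= [[x Kx <-] [_ [y Ky ->] <-]]] <-].
  exists (v2r (y ord0), v2r (\sum_i y (lift ord0 i))).
    split; first by exists (y ord0).
    by exists (\sum_i y (lift ord0 i)) => //; exists (fun i => y (lift ord0 i)).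
  by rewrite big_ord_recl linearD.
exists (x + \sum_i y i); last by rewrite linearD.
exists (fun i => if unlift ord0 i is Some j then y j else x).
  by move=> i; case: unliftP.
rewrite big_ord_recl unlift_none; congr (_ + _).
by apply: eq_bigr => i _; rewrite liftK.
Qed.

Lemma coord_le_norm n (x : 'rV[R]_n) i : `|x 0 i| <= `|x|.
Proof.
rewrite [leRHS]/Num.norm /= mx_normrE; apply/bigmax_geP; right => /=.
by exists (0, i).
Qed.

(** On the compact set of unit vectors of C the functional has a positive
    minimum e; by homogeneity e |x| <= phi x on C, so the slice is bounded. *)
Lemma compact_slice V (C : set V) (phi : dual V) (M : R) :
  closed_convex_cone C -> (forall x, C x -> x != 0 -> (0 : R) < phi x) ->
  compact (v2r @` (C `&` [set x | phi x <= M])).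
Proof.
move=> [[C0 CD CZ] clC] pos.
pose f (y : 'rV[R]_(dim V)) : R := phi (r2v y).
have cf : continuous f by exact: form_continuous.
have clC' : closed (r2v @^-1` C) by rewrite -vclosedE.
have clN (g : R -> Prop) (h : closed g) : closed [set y : 'rV[R]_(dim V) | g `|y|].
  apply: (@closed_comp _ _ (fun y : 'rV[R]_(dim V) => `|y|) g) => // y _.
  exact: norm_continuous.
pose S := (r2v @^-1` C) `&` [set y : 'rV[R]_(dim V) | `|y| = 1].
have clS : closed S by apply: closedI => //; apply: (clN [set t | t = 1]); exact: closed_eq.
have cS : compact S.
  apply: subclosed_compact clS (@compact_box (dim V) 1) _ => y [_ /= <-] i.
  exact: coord_le_norm.
have [e e0 He] : exists2 e : R, 0 < e & forall y, S y -> e <= f y.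
  have [S0|/set0P/negP/negPn/eqP S0] := pselect (S !=set0); last first.
    by exists 1 => // y; rewrite S0.
  have [|p] := @compact_EVT_min _ R f S S0 cS.
    exact: continuous_subspaceT.
  rewrite inE => -[Cp /= np] Hp; exists (f p); last by move=> y Sy; apply: Hp; rewrite inE.
  apply: pos => //; apply: contra_eq_neq np => p0.
  have -> : p = 0 by rewrite -[p]r2vK p0 linear0.
  by rewrite normr0 eq_sym oner_neq0.
have bound y : C (r2v y) -> e * `|y| <= f y.
  move=> Cy; have [->|y0] := eqVneq y 0.
    by rewrite normr0 mulr0 /f !linear0.
  have ny : 0 < `|y| by rewrite normr_gt0.
  have : S (`|y|^-1 *: y).
    split; first by rewrite /= linearZ; apply: CZ => //; rewrite invr_ge0 ltW.
    by rewrite /= normrZ ger0_norm ?invr_ge0 ?(ltW ny) // mulVf ?gt_eqF.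
  move/He; rewrite /f linearZ [X in _ <= X]linearZ /=.
  by move=> h; rewrite mulrC -ler_pdivlMl.
rewrite (_ : v2r @` _ = (r2v @^-1` C) `&` [set y | f y <= M]); last first.
  apply/seteqP; split=> [_ [x [Cx Mx] <-]|y [Cy My]].
    by split; rewrite /= /f v2rK.
  by exists (r2v y); rewrite ?r2vK.
have clfM : closed [set y | f y <= M].
  by apply: (@closed_comp _ _ f [set t | t <= M]) => [y _|]; [exact: cf|exact: closed_le].
apply: subclosed_compact (closedI clC' clfM) (@compact_box (dim V) (M / e)) _.
move=> y [Cy /= My] i; apply: (le_trans (coord_le_norm y i)).
by rewrite ler_pdivlMr // mulrC; apply: le_trans (bound y Cy) My.
Qed.

(** Near a point y of the closure of A only the points below the level
    phi y + 1 matter, and these lie in a compact, hence closed, subset of A. *)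
Lemma vclosed_compact_sublevels V (A : set V) (phi : dual V) (K : R -> set V) :
  (forall M, compact (v2r @` K M)) -> (forall M, K M `<=` A) ->
  (forall M x, A x -> phi x < M -> K M x) -> vclosed A.
Proof.
move=> cK KA AK; rewrite vclosedE => y cly.
pose f (z : 'rV[R]_(dim V)) : R := phi (r2v z).
pose M := f y + 1.
have cf : continuous f by exact: form_continuous.
suff : (v2r @` K M) y by move=> [x Kx <-]; rewrite /= v2rK; exact: KA Kx.
have : closed (v2r @` K M) by apply: compact_closed (cK M); exact: norm_hausdorff.
apply => B By.
have opM : open [set z | f z < M].
  by apply: (@open_comp _ _ f [set t | t < M]) => [z _|]; [exact: cf | exact: open_lt].
have : nbhs y (B `&` [set z | f z < M]).
  by apply: filterI => //; apply: open_nbhs_nbhs; split; rewrite //= /M ltrDl.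
move=> /cly [z [Az [Bz fz]]]; exists z; split=> //.
by exists (r2v z); [exact: AK | rewrite r2vK].
Qed.

(** * The minimal and maximal tensor products are closed *)

Lemma min_tensorE V W (C : set V) (D : set W) :
  min_tensor C D =
  \bigcup_n sums [set t | exists2 c, C c & exists2 d, D d & t = tens c d] n.
Proof.
apply/seteqP; split=> [_ [n [c [d [cd ->]]]]|_ [n _ [z Qz ->]]].
  by exists n => //; exists (fun i => tens (c i) (d i)) => // i;
    have [Cc Dd] := cd i; exists (c i) => //; exists (d i).
have /choice[k Hk] : forall i, exists k : V * W,
    [/\ C k.1, D k.2 & z i = tens k.1 k.2].
  by move=> i; have [c Cc [d Dd ->]] := Qz i; exists (c, d).
exists n, (fun i => (k i).1), (fun i => (k i).2).
by split=> [i|]; [have [] := Hk i | apply: eq_bigr => i _; have [] := Hk i].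
Qed.

Lemma convex_cone_min_tensor V W (C : set V) (D : set W) :
  convex_cone C -> convex_cone (min_tensor C D).
Proof.
move=> [_ _ CZ]; rewrite min_tensorE; apply: convex_cone_sums.
move=> a _ a0 [c Cc [d Dd ->]]; exists (a *: c); first exact: CZ.
by exists d; rewrite // tensZl.
Qed.

(** The functional om = phi ⊗ psi bounds each summand c ⊗ d of a tensor t by
    om t.  Rescaling to psi d <= 1 and phi c <= om t makes both factors range
    over compact slices, and the number of summands is at most the dimension. *)
Lemma vclosed_min_tensor_pointed V W (C : set V) (D : set W) (phi : dual V) (psi : dual W) :
  closed_convex_cone C -> closed_convex_cone D ->
  (forall x, C x -> x != 0 -> (0 : R) < phi x) ->
  (forall x, D x -> x != 0 -> (0 : R) < psi x) ->
  vclosed (min_tensor C D).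
Proof.
move=> hC hD posC posD.
have [[C0 CD CZ] _] := hC; have [[D0 DD DZ] _] := hD.
have phi0 c : C c -> (0 : R) <= phi c.
  by move=> Cc; have [->|c0] := eqVneq c 0; [rewrite linear0|exact/ltW/posC].
have psi0 d : D d -> (0 : R) <= psi d.
  by move=> Dd; have [->|d0] := eqVneq d 0; [rewrite linear0|exact/ltW/posD].
pose Q := [set t | exists2 c, C c & exists2 d, D d & t = tens c d].
have Q0 : Q 0.
  by exists 0 => //; exists 0 => //; rewrite -[X in tens X](scale0r 0) tensZl scale0r.
have QZ (a : R) x : 0 <= a -> Q x -> Q (a *: x).
  move=> a0 [c Cc [d Dd ->]]; exists (a *: c); first exact: CZ.
  by exists d; rewrite // tensZl.
pose om : dual (tensor V W) := linfun (fun t : tensor V W => phi (t psi)).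
have omE c d : om (tens c d) = psi d * phi c :> R.
  rewrite linfunE; last by move=> a x y; rewrite add_lfunE scale_lfunE linearP.
  by rewrite tensE linearZ.
pose q M := [set t | exists2 c, (C `&` [set x | phi x <= M]) c &
  exists2 d, (D `&` [set x | psi x <= 1]) d & t = tens c d].
pose N := \dim {:tensor V W}.
rewrite min_tensorE -/Q.
apply: (@vclosed_compact_sublevels _ _ om (fun M => sums (q M) N)) => [M|M|M x].
- apply: compact_sums.
  pose tn (p : 'rV[R]_(dim V) * 'rV[R]_(dim W)) := v2r (tens (r2v p.1 : V) (r2v p.2 : W)).
  rewrite (_ : _ @` _ = tn @` ((v2r @` (C `&` [set x | phi x <= M])) `*`
                              (v2r @` (D `&` [set x | psi x <= 1])))).
    apply: continuous_compact.
      by apply: continuous_subspaceT; exact: tens_continuous.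
    by apply: compact_setX; exact: compact_slice.
  apply/seteqP; split=> [_ [_ [c Cc [d Dd ->]] <-]|_ [[_ _] /= [[c Cc <-] [d Dd <-]]] <-].
    by exists (v2r c, v2r d); [split; [exists c|exists d] | rewrite /tn /= !v2rK].
  by exists (tens c d); [exists c => //; exists d | rewrite /tn /= !v2rK].
- move=> _ [y Qy ->]; exists N => //; exists y => // i.
  by have [c [Cc _] [d [Dd _] ->]] := Qy i; exists c => //; exists d.
- move=> [n _ /(sums_dim Q0 QZ) [y Qy ->]] omM; exists y => // i.
  have om0 t : Q t -> 0 <= (om t : R).
    by move=> [c Cc [d Dd ->]]; rewrite omE mulr_ge0 ?phi0 ?psi0.
  have : (om (y i) : R) < M.
    apply: le_lt_trans omM; rewrite linear_sum (bigD1 i) //= lerDl.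
    by apply: sumr_ge0 => j _; exact: om0.
  have M0 : 0 < M.
    apply: le_lt_trans omM; rewrite linear_sum; apply: sumr_ge0 => j _; exact: om0.
  have [c Cc [d Dd ->]] := Qy i; rewrite omE => lM.
  (* A zero factor d admits no normalization, but then the tensor is 0 ⊗ 0. *)
  have [d0|d0] := eqVneq d 0.
    exists 0; first by split=> //; rewrite /= linear0 ltW.
    exists 0; first by split=> //; rewrite /= linear0 ler01.
    by rewrite d0 -[0 in RHS](scale0r c) tens_scale scale0r.
  have pd := posD d Dd d0.
  exists ((psi d : R) *: c).
    split; first by apply: CZ => //; exact: ltW.
    by rewrite /= linearZ; exact: ltW.
  exists ((psi d : R)^-1 *: d).
    split; first by apply: DZ => //; rewrite invr_ge0 ltW.
    by rewrite /= linearZ /= [X in X <= _]mulVf // gt_eqF.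
  by rewrite tens_scale scalerA mulfV ?scale1r // gt_eqF.
Qed.

(** Membership of t in the product of C and D is a condition on the components of
    t under P = p ⊗ q and 1 - P: replacing c ⊗ d by p c ⊗ q d changes it by
    (c - p c) ⊗ d + p c ⊗ (d - q d), both terms of which lie in the lineality
    space N of the product. *)
Lemma vclosed_min_tensor V W (C : set V) (D : set W) :
  closed_convex_cone C -> closed_convex_cone D -> vclosed (min_tensor C D).
Proof.
move=> hC hD; have [cC _] := hC.
have [p [phi [pC pL clC0 pp posC]]] := split_lineality hC.
have [q [psi [qD qL clD0 qq posD]]] := split_lineality hD.
set C0 := _ `&` _ in clC0 posC; set D0 := _ `&` _ in clD0 posD.
have clT0 := vclosed_min_tensor_pointed clC0 clD0 posC posD.
have cT := convex_cone_min_tensor D cC.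
have [N NP] := lineality_vspace cT.
have [T0 TD TZ] := cT.
pose P : 'End(tensor V W) := tensor_map p q.
have tT c d : C c -> D d -> min_tensor C D (tens c d).
  by move=> Cc Dd; exists 1%N, (fun=> c), (fun=> d); rewrite big_ord1.
rewrite (_ : min_tensor C D =
  P @^-1` min_tensor C0 D0 `&` (\1 - P)%VF @^-1` [set t | t \in N]).
  by apply: vclosedI; apply: vclosed_preimage_hom => //; exact: vclosed_vspace.
apply/seteqP; split=> [_ [n [c [d [cd ->]]]]|t [/= Pt]]; last first.
  rewrite add_lfunE opp_lfunE id_lfunE => /NP[Tt _].
  rewrite -[t](subrK (P t)); apply: TD => //.
  case: Pt => n [c [d [cd ->]]]; exists n, c, d; split=> // i.
  by have [[] ? _ [] ? _] := cd i.
split.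
  exists n, (p \o c), (q \o d); split.
    move=> i; have [Cc Dd] := cd i; split; split=> /=; [exact: pC| exact: pp |exact: qD|exact: qq].
  by rewrite linear_sum; apply: eq_bigr => i _; exact: tensor_mapE.
rewrite /= (linear_sum_fun _ _ _ (hom_linear _)); apply: memv_suml => i _; have [Cc Dd] := cd i.
rewrite add_lfunE opp_lfunE id_lfunE /P tensor_mapE.
have -> : tens (c i) (d i) - tens (p (c i)) (q (d i)) =
    tens (c i - p (c i)) (d i) + tens (p (c i)) (d i - q (d i)).
  by rewrite tensBl tensBr addrA subrK.
apply: memvD; apply/NP.
  by have [? ?] := pL _ Cc; rewrite -tensNl opprB; split; exact: tT.
by have [? ?] := qL _ Dd; rewrite -tensNr opprB; split; apply: tT => //; exact: pC.
Qed.

(** Generators phi ⊗ psi suffice to test membership in the dual of the minimal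
    tensor product of the duals. *)
Lemma max_tensorP V W (C : set V) (D : set W) t : max_tensor C D t <->
  (forall phi psi, dual_cone C phi -> dual_cone D psi -> (0 : R) <= phi (t psi)).
Proof.
split=> [Ht phi psi Cphi Dpsi|Ht _ [n [phi [psi [H ->]]]]].
  rewrite -tensor_bidual_app; apply: Ht.
  by exists 1%N, (fun=> phi), (fun=> psi); rewrite big_ord1.
rewrite (linear_sum_fun _ _ _ (hom_linear _)); apply: sumr_ge0 => i _.
by rewrite tensor_bidual_app; have [? ?] := H i; exact: Ht.
Qed.

Lemma closed_convex_cone_max_tensor V W (C : set V) (D : set W) :
  closed_convex_cone (max_tensor C D).
Proof.
exact/closed_convex_cone_preimage/closed_convex_cone_dual.
Qed.

Lemma closed_convex_cone_min_tensor V W (C : set V) (D : set W) :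
  closed_convex_cone C -> closed_convex_cone D ->
  closed_convex_cone (min_tensor C D).
Proof.
move=> hC hD; split; last exact: vclosed_min_tensor.
by apply: convex_cone_min_tensor; case: hC.
Qed.

End Cones.

(** * Systems over a stem *)

Section Stem.
Variable R : realType.
Variables (C : star_autonomous) (S : stem R C).

Lemma smor_cmp (a b c : C) (g : mor b c) (f : mor a b) v :
  smor S (cmp g f) v = smor S g (smor S f v).
Proof. by rewrite /smor fmor_cmp /= comp_lfunE. Qed.

Lemma smor1 (a : C) v : smor S (idm a) v = v.
Proof. by rewrite /smor fmor1 /= id_lfunE. Qed.

Lemma cointrinsic_cone_min (c : C) (K : set (sob S c)) : closed_convex_cone K ->
  (forall Phi : mor unit_ob c, K (smor S Phi (sone S))) ->
  cointrinsic_cone S c `<=` K.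
Proof.
move=> [cK clK] HK; apply: vclosure_min => //.
by apply: conic_hull_min => // _ [Phi _ <-].
Qed.

Lemma cointrinsic_cone_mor (c : C) (Phi : mor unit_ob c) :
  cointrinsic_cone S c (smor S Phi (sone S)).
Proof. by apply/sub_vclosure/sub_conic_hull; exists Phi. Qed.

Lemma closed_convex_cone_cointrinsic (c : C) :
  closed_convex_cone (cointrinsic_cone S c).
Proof.
split; last exact: vclosed_vclosure.
exact/convex_cone_vclosure/convex_cone_conic_hull.
Qed.

Lemma cointrinsic_cone_smor (c d : C) (f : mor c d) :
  cointrinsic_cone S c `<=` smor S f @^-1` cointrinsic_cone S d.
Proof.
apply: cointrinsic_cone_min => [|Phi].
  exact/closed_convex_cone_preimage/closed_convex_cone_cointrinsic.
by rewrite /= -smor_cmp; exact: cointrinsic_cone_mor.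
Qed.

Lemma intrinsic_cone_smor (c d : C) (f : mor c d) :
  intrinsic_cone S c `<=` smor S f @^-1` intrinsic_cone S d.
Proof. by move=> v Av phi; rewrite -smor_cmp; exact: Av. Qed.

Variable X : vectType R.

Lemma from_unit_star_app (t : tensor X (sob S (star unit_ob))) :
  from_unit_star S t = t (sunit_star S).
Proof.
rewrite comp_lfunE tensor_runit_app tensor_map_app id_lfunE; congr (t _).
by apply/lfunP => v; rewrite dual_mapE id_lfunE.
Qed.

Variables (D : set X) (hD : closed_convex_cone D).

Lemma is_system_min : is_system (min_system S D).
Proof.
split=> [c|c d f _ [_ [n [x [b [xb ->]]]] <-]].
  exact/closed_convex_cone_min_tensor/closed_convex_cone_cointrinsic.
exists n, x, (fun i => smor S f (b i)); split.
  by move=> i; have [Dx Bb] := xb i; split=> //; exact: cointrinsic_cone_smor.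
rewrite (linear_sum_fun _ _ _ (hom_linear _)).
by apply: eq_bigr => i _; rewrite tensor_mapE id_lfunE.
Qed.

Lemma min_system_contains : contains_at_unit D (min_system S D).
Proof.
move=> _ [x Dx <-]; exists 1%N, (fun=> x), (fun=> sone S).
rewrite big_ord1; split=> // _; split=> //.
by rewrite -[sone S]smor1; exact: cointrinsic_cone_mor.
Qed.

(** For fixed x in D the vectors b with x ⊗ b in G c form a closed convex cone
    containing the generators of the cointrinsic cone. *)
Lemma min_system_smallest (G : cone_family S X) :
  is_system G -> contains_at_unit D G -> subfamily (min_system S D) G.
Proof.
move=> [clG fG] DG c _ [n [x [b [xb ->]]]].
apply: (convex_cone_sum _ (clG c).1) => i; have [Dx Bb] := xb i.
pose f : 'Hom(sob S c, tensor X (sob S c)) := linfun (tens (x i)).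
have fE w : f w = tens (x i) w by rewrite linfunE //; exact: (tens_bilin _ _).1.
suff /(_ _ Bb) : cointrinsic_cone S c `<=` f @^-1` G c by rewrite /= fE.
apply: cointrinsic_cone_min => [|Phi]; first exact: closed_convex_cone_preimage.
rewrite /= fE; apply: (fG _ _ Phi); exists (at_unit S (x i)).
  by apply: DG; exists (x i).
by rewrite tensor_mapE id_lfunE.
Qed.

Lemma is_system_max : is_system (max_system S D).
Proof.
split=> [c|c d f _ [t /max_tensorP Ht <-]].
  exact: closed_convex_cone_max_tensor.
apply/max_tensorP => phi psi Dphi Apsi.
rewrite tensor_map_app id_lfunE; apply: Ht => // v Av.
by rewrite dual_mapE; apply: Apsi; exact: intrinsic_cone_smor.
Qed.

(** The identity of 1^* is one of the morphisms that define the intrinsic cone of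
    1^*, so the canonical functional on S(1^* ) is nonnegative on that cone. *)
Lemma max_system_contained : contained_at_unit_star D (max_system S D).
Proof.
move=> _ [t /max_tensorP Ht <-]; apply: bipolar hD _ => phi Dphi.
rewrite from_unit_star_app; apply: Ht => // v Av.
by have := Av (idm _); rewrite smor1.
Qed.

(** The contraction v of t with phi lies in the intrinsic cone of c: its value
    under a morphism f : c -> 1^* is phi at the image of t in D. *)
Lemma max_system_largest (G : cone_family S X) :
  is_system G -> contained_at_unit_star D G -> subfamily G (max_system S D).
Proof.
move=> [clG fG] GD c t Gt; apply/max_tensorP => phi psi Dphi Apsi.
have [v Hv] := contract_left phi t; rewrite -Hv; apply: Apsi => f.
rewrite -dual_mapE Hv -[t _]id_lfunE -tensor_map_app -from_unit_star_app.
apply: Dphi; apply: GD; exists (tensor_map \1%VF (smor S f) t) => //.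
by apply: (fG _ _ f); exists t.
Qed.

End Stem.

Theorem proposition3p9 (R : realType) (C : star_autonomous) (S : stem R C)
    (X : vectType R) (D : set X) (hD : closed_convex_cone D) :
  (is_system (min_system S D) /\ contains_at_unit D (min_system S D) /\
   forall G : cone_family S X, is_system G -> contains_at_unit D G ->
     subfamily (min_system S D) G) /\
  (is_system (max_system S D) /\ contained_at_unit_star D (max_system S D) /\
   forall G : cone_family S X, is_system G -> contained_at_unit_star D G ->
     subfamily G (max_system S D)).
Proof.
split; [split; last split | split; last split].
- exact: is_system_min.
- exact: min_system_contains.
- exact: min_system_smallest.
- exact: is_system_max.
- exact: max_system_contained.
- exact: max_system_largest.
Qed.
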